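(* Let $\mathcal{C}$ be an abelian track category with zero maps. Define $\mathbf{A}=\pi_0\mathcal{C}$; $D(X,Y)=\mathrm{Aut}_{\mathcal{C}}(o_{X,Y})$; the $1$-graded category $\mathbf{T}$ with $\mathrm{Mor}_{\mathbf{T}}(X,Y)_0=\mathrm{Mor}_{\mathcal{C}}(X,Y)_0$ (the maps $X\to Y$) and $\mathrm{Mor}_{\mathbf{T}}(X,Y)_1=\{(F,f)\mid F:f\to o_{X,Y}\}$ (the tracks ending at the zero map), with $\partial^1(F,f)=f$ and zero elements $o^0=o_{X,Y}$, $o^1=\mathrm{id}_{o_{X,Y}}$; and, for $a_1=(F,f)$, $a_2=(G,g)$ with $f=g$, $$\mathcal{O}_B(a_1,a_2):=FG^{-1}\in\mathrm{Aut}_{\mathcal{C}}(o_{X,Y}),$$ where $B$ is the (up to equivalence unique) left cubical ball of dimension $1$. Then $\mathrm{Nul}_1(\mathcal{C})=(\mathbf{T},\mathbf{A},D,\mathcal{O})$ is an algebra of left $1$-cubical balls.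
   Context: **Track categories.** A track category is a category $\mathcal{C}$ enriched in groupoids: $\mathrm{Mor}_{\mathcal{C}}(X,Y)$ is a groupoid with objects the maps $f:X\to Y$ (dimension $0$, forming the category $\mathcal{C}_0$) and morphisms $F:f\to g$ the tracks (dimension $1$). One writes $f\simeq g$ if there is a track $f\to g$; $\pi_0\mathcal{C}=\mathcal{C}_0/\!\simeq$. $\mathrm{Aut}_{\mathcal{C}}(f)$ is the group of tracks $f\to f$; $\mathcal{C}$ is abelian if all $\mathrm{Aut}_{\mathcal{C}}(f)$ are abelian. $\mathcal{C}$ has zero maps $o_{X,Y}\in\mathrm{Mor}_{\mathcal{C}}(X,Y)_0$, so that composites with a zero map are zero maps, and composing a track with a zero map gives the identity track of a zero map. $D$ is a bifunctor $\mathbf{A}^{op}\times\mathbf{A}\to\mathrm{Ab}$ via composition; composition in $\mathbf{T}$ is given by composition in $\mathcal{C}$ of maps with maps and maps with tracks. $FG^{-1}$ is composition in the groupoid (first $G^{-1}:o\to f$, then $F:f\to o$). **Algebra of left $1$-cubical balls.** A $1$-graded category $\mathbf{T}$ has morphism sets $\mathrm{Mor}(X,Y)_0,\mathrm{Mor}(X,Y)_1$ and an associative composition $fg$ defined when $\dim f+\dim g\le1$, with $\dim(fg)=\dim f+\dim g$, and identities of dimension $0$; its $0$-dimensional morphisms form the category $\mathbf{T}^0$. Every left cubical ball of dimension $1$ is the double of $I=[0,1]$: two intervals glued at $0$, the first of orientation sign $+1$, the second of sign $-1$. An algebra of left $1$-cubical balls $(\mathbf{T},\mathbf{A},D,\mathcal{O})$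 consists of the following. (1) $\mathbf{T}$ is a $1$-graded category with operators $\partial^1:\mathrm{Mor}(X,Y)_1\to\mathrm{Mor}(X,Y)_0$ and zero elements $o^t\in\mathrm{Mor}(X,Y)_t$, preserved by $\partial^1$, with $\partial^1(fg)=(\partial^1f)g$ if $\dim f=1$, $\partial^1(fg)=f(\partial^1g)$ if $\dim f=0,\dim g=1$, and $o^tg=o^{t+\dim g}$, $fo^t=o^{\dim f+t}$. (2) A full functor $q:\mathbf{T}^0\to\mathbf{A}$, identity on objects, and a bifunctor $D:\mathbf{A}^{op}\times\mathbf{A}\to\mathrm{Ab}$ on which zero maps induce zero homomorphisms; for $f\in\mathrm{Mor}(X,Y)_0$, $q(f)=q(o^0)$ iff there is $F\in\mathrm{Mor}(X,Y)_1$ with $\partial^1F=f$. (3) For all $a_1,a_2\in\mathrm{Mor}(X,Y)_1$ with $\partial^1a_1=\partial^1a_2$ (gluing condition) an element $\mathcal{O}(a_1,a_2)\in D(X,Y)$ such that: complement rule: $\mathcal{O}(a,c)=0$ implies $\mathcal{O}(a,b)=\mathcal{O}(c,b)$ and $\mathcal{O}(b,a)=\mathcal{O}(b,c)$; double rule: $\mathcal{O}(a,a)=0$; for every $a$ and $\alpha\in D(X,Y)$ there is a unique $b=:a+\alpha$ with $\mathcal{O}(b,a)=\alpha$, and this defines an effective and transitive action of $D(X,Y)$ on each set of elements $a$ with $\partial^1a$ fixed; action formula: $\mathcal{O}(a+\alpha,b)=\mathcal{O}(a,b)+\alpha$ and $\mathcal{O}(a,b+\alpha)=\mathcal{O}(a,b)-\alpha$.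 (4) Naturality: $\mathcal{O}(ga_1,ga_2)=g_*\mathcal{O}(a_1,a_2)$ and $\mathcal{O}(a_1f,a_2f)=f^*\mathcal{O}(a_1,a_2)$ for $f,g$ of dimension $0$. (5) Triviality: for $Z\xleftarrow{f}Y\xleftarrow{g}X$ with $\dim f=\dim g=1$, $\mathcal{O}((\partial^1f)g,f(\partial^1g))=0$. *)

(* Defs.v *)
From HB Require Import structures.
From mathcomp Require Import all_boot all_algebra.
From mathcomp Require Import boolp.

Set Implicit Arguments.
Unset Strict Implicit.
Unset Printing Implicit Defensive.

Import GRing.Theory.
Local Open Scope ring_scope.
Local Open Scope quotient_scope.

(** * Categories and groupoids *)

(* The class of objects is a parameter, so that "identity on objects" is
   expressed by having two categories over the same [Ob]. *)
Record category (Ob : Type) := Category {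
  hom : Ob -> Ob -> Type;
  idm : forall X, hom X X;
  comp : forall X Y Z, hom Y Z -> hom X Y -> hom X Z;
  compA : forall X Y Z W (h : hom Z W) (g : hom Y Z) (f : hom X Y),
    comp h (comp g f) = comp (comp h g) f;
  comp1m : forall X Y (f : hom X Y), comp (idm Y) f = f;
  compm1 : forall X Y (f : hom X Y), comp f (idm X) = f
}.

Arguments idm {Ob} c X.
Arguments comp {Ob c X Y Z}.
Notation "g \c f" := (comp g f) (at level 40, left associativity).

Record groupoid := Groupoid {
  gob :> Type;
  track : gob -> gob -> Type;
  gid : forall f, track f f;
  gcomp : forall f g h, track g h -> track f g -> track f h;
  ginv : forall f g, track f g -> track g f;
  gcompA : forall f g h k (H : track h k) (G : track g h) (F : track f g),
    gcomp H (gcomp G F) = gcomp (gcomp H G) F;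
  gcomp1t : forall f g (F : track f g), gcomp (gid g) F = F;
  gcompt1 : forall f g (F : track f g), gcomp F (gid f) = F;
  gcompVt : forall f g (F : track f g), gcomp (ginv F) F = gid f;
  gcomptV : forall f g (F : track f g), gcomp F (ginv F) = gid g
}.

Arguments track {M} : rename.
Arguments gid {M} : rename.
Arguments gcomp {M f g h} : rename.
Arguments ginv {M f g} : rename.
Notation "F \v G" := (gcomp F G) (at level 40, left associativity).

(* Transport along equalities of source and target. *)
Definition gcast (M : groupoid) (f f' g g' : M) (ef : f = f') (eg : g = g')
    (F : track f g) : track f' g' :=
  let: erefl := ef in let: erefl := eg in F.

(* [same_track F G]: F and G are the same arrow of the groupoid [M], although
   their sources and targets need only be propositionally equal. *)
Definition total_track (M : groupoid) (f g : M) (F : track f g) :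
    {e : M * M & track e.1 e.2} :=
  existT (fun e : M * M => track e.1 e.2) (f, g) F.

Definition same_track (M : groupoid) (f g f' g' : M)
    (F : track f g) (G : track f' g') : Prop :=
  total_track F = total_track G.

(** * Track categories *)

(* [mcomp] and [hcomp] are the action on objects and on arrows of the
   composition functor Mor(Y,Z) x Mor(X,Y) -> Mor(X,Z). *)
Record trackCategory := TrackCategory {
  tob :> Type;
  Mor : tob -> tob -> groupoid;
  mid : forall X, Mor X X;
  mcomp : forall X Y Z, Mor Y Z -> Mor X Y -> Mor X Z;
  hcomp : forall X Y Z (f f' : Mor Y Z) (g g' : Mor X Y),
    track f f' -> track g g' -> track (mcomp f g) (mcomp f' g');
  hcomp_gid : forall X Y Z (f : Mor Y Z) (g : Mor X Y),
    hcomp (gid f) (gid g) = gid (mcomp f g);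
  hcomp_gcomp : forall X Y Z (f f' f'' : Mor Y Z) (g g' g'' : Mor X Y)
      (F' : track f' f'') (F : track f f') (G' : track g' g'') (G : track g g'),
    hcomp (F' \v F) (G' \v G) = hcomp F' G' \v hcomp F G;
  mcompA : forall X Y Z W (h : Mor Z W) (g : Mor Y Z) (f : Mor X Y),
    mcomp h (mcomp g f) = mcomp (mcomp h g) f;
  mcomp1m : forall X Y (f : Mor X Y), mcomp (mid Y) f = f;
  mcompm1 : forall X Y (f : Mor X Y), mcomp f (mid X) = f;
  hcompA : forall X Y Z W (h h' : Mor Z W) (g g' : Mor Y Z) (f f' : Mor X Y)
      (H : track h h') (G : track g g') (F : track f f'),
    same_track (hcomp H (hcomp G F)) (hcomp (hcomp H G) F);
  hcomp1t : forall X Y (f f' : Mor X Y) (F : track f f'),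
    same_track (hcomp (gid (mid Y)) F) F;
  hcompt1 : forall X Y (f f' : Mor X Y) (F : track f f'),
    same_track (hcomp F (gid (mid X))) F
}.

Arguments mid {t} X.
Notation "g \m f" := (mcomp g f) (at level 40, left associativity).
Notation "G \h F" := (hcomp G F) (at level 40, left associativity).

Definition C0 (C : trackCategory) : category C :=
  @Category C (fun X Y => Mor X Y) (fun X => mid X) (fun X Y Z => @mcomp C X Y Z)
    (@mcompA C) (@mcomp1m C) (@mcompm1 C).

Record zeroMaps (C : trackCategory) := ZeroMaps {
  zm :> forall X Y : C, Mor X Y;
  zm_mcompl : forall (X Y Z : C) (f : Mor X Y), zm Y Z \m f = zm X Z;
  zm_mcompr : forall (X Y Z : C) (f : Mor Y Z), f \m zm X Y = zm X Z;
  zm_hcompl : forall (X Y Z : C) (f f' : Mor X Y) (F : track f f'),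
    same_track (gid (zm Y Z) \h F) (gid (zm X Z));
  zm_hcompr : forall (X Y Z : C) (f f' : Mor Y Z) (F : track f f'),
    same_track (F \h gid (zm X Y)) (gid (zm X Z))
}.

Definition abelian_tracks (C : trackCategory) : Prop :=
  forall (X Y : C) (f : Mor X Y), commutative (@gcomp (Mor X Y) f f f).

(** * The homotopy category *)

Section HomotopyCategory.
Variable C : trackCategory.

Definition homotopic (X Y : C) : rel {classic Mor X Y} :=
  fun f g => `[< inhabited (track (f : Mor X Y) g) >].

Lemma homotopic_refl (X Y : C) : reflexive (@homotopic X Y).
Proof. by move=> f; apply/asboolP; exists; exact: gid. Qed.

Lemma homotopic_sym (X Y : C) : symmetric (@homotopic X Y).
Proof.
by move=> f g; apply/asboolP/asboolP => -[F]; exists; exact: ginv.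
Qed.

Lemma homotopic_trans (X Y : C) : transitive (@homotopic X Y).
Proof.
move=> g f h /asboolP[F] /asboolP[G]; apply/asboolP; exists.
exact: gcomp G F.
Qed.

Canonical homotopic_equiv (X Y : C) : equiv_rel {classic Mor X Y} :=
  EquivRel (@homotopic X Y) (@homotopic_refl X Y) (@homotopic_sym X Y)
    (@homotopic_trans X Y).

Definition hclass (X Y : C) : Type := {eq_quot @homotopic_equiv X Y}.

Definition to_hclass (X Y : C) (f : Mor X Y) : hclass X Y :=
  \pi_({eq_quot @homotopic_equiv X Y}) (f : {classic Mor X Y}).

Definition of_hclass (X Y : C) (u : hclass X Y) : Mor X Y :=
  repr (u : {eq_quot @homotopic_equiv X Y}).

Lemma of_hclassK (X Y : C) (u : hclass X Y) : to_hclass (of_hclass u) = u.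
Proof. exact: reprK. Qed.

Lemma to_hclassP (X Y : C) (f g : Mor X Y) :
  to_hclass f = to_hclass g <-> inhabited (track f g).
Proof.
split=> [/eqmodP /asboolP//|fg].
by apply/eqmodP/asboolP.
Qed.

Lemma to_hclass_of (X Y : C) (f : Mor X Y) :
  inhabited (track (of_hclass (to_hclass f)) f).
Proof. by apply/to_hclassP; rewrite of_hclassK. Qed.

Definition hclass_comp (X Y Z : C) (v : hclass Y Z) (u : hclass X Y) :
    hclass X Z :=
  to_hclass (of_hclass v \m of_hclass u).

Lemma hclass_compE (X Y Z : C) (g : Mor Y Z) (f : Mor X Y) :
  hclass_comp (to_hclass g) (to_hclass f) = to_hclass (g \m f).
Proof.
have [G] := to_hclass_of g; have [F] := to_hclass_of f.
by apply/to_hclassP; exists; exact: hcomp.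
Qed.

Lemma hclass_compA (X Y Z W : C) (w : hclass Z W) (v : hclass Y Z)
    (u : hclass X Y) :
  hclass_comp w (hclass_comp v u) = hclass_comp (hclass_comp w v) u.
Proof.
rewrite -(of_hclassK w) -(of_hclassK v) -(of_hclassK u).
by rewrite !hclass_compE mcompA.
Qed.

Lemma hclass_comp1m (X Y : C) (u : hclass X Y) :
  hclass_comp (to_hclass (mid Y)) u = u.
Proof. by rewrite -(of_hclassK u) hclass_compE mcomp1m. Qed.

Lemma hclass_compm1 (X Y : C) (u : hclass X Y) :
  hclass_comp u (to_hclass (mid X)) = u.
Proof. by rewrite -(of_hclassK u) hclass_compE mcompm1. Qed.

Definition pi0 : category C :=
  @Category C hclass (fun X => to_hclass (mid X)) hclass_comp
    hclass_compA hclass_comp1m hclass_compm1.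

End HomotopyCategory.

(** * Algebras of left 1-cubical balls *)

(* In composites, [gcomp10 f g] has dim f = 1, dim g = 0 and [gcomp01 f g] has
   dim f = 0, dim g = 1. *)
Record graded1Data (Ob : Type) := Graded1Data {
  mor0 :> category Ob;
  mor1 : Ob -> Ob -> Type;
  gcomp10 : forall X Y Z, mor1 Y Z -> hom mor0 X Y -> mor1 X Z;
  gcomp01 : forall X Y Z, hom mor0 Y Z -> mor1 X Y -> mor1 X Z
}.

Arguments mor1 {Ob} g X Y.
Arguments gcomp10 {Ob g X Y Z}.
Arguments gcomp01 {Ob g X Y Z}.
Notation "f \c10 g" := (gcomp10 f g) (at level 40, left associativity).
Notation "f \c01 g" := (gcomp01 f g) (at level 40, left associativity).

Record is_graded1_category (Ob : Type) (T : graded1Data Ob) : Prop := {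
  gcomp100A : forall X Y Z W (f : mor1 T Z W) (g : hom T Y Z) (h : hom T X Y),
    f \c10 (g \c h) = (f \c10 g) \c10 h;
  gcomp010A : forall X Y Z W (f : hom T Z W) (g : mor1 T Y Z) (h : hom T X Y),
    f \c01 (g \c10 h) = (f \c01 g) \c10 h;
  gcomp001A : forall X Y Z W (f : hom T Z W) (g : hom T Y Z) (h : mor1 T X Y),
    f \c01 (g \c01 h) = (f \c g) \c01 h;
  gcomp01_id : forall X Y (f : mor1 T X Y), idm T Y \c01 f = f;
  gcomp10_id : forall X Y (f : mor1 T X Y), f \c10 idm T X = f
}.

(* Bifunctors A^op x A -> Ab: [bimap u v] is the homomorphism D(u, v). *)
Record bifunctorData (Ob : Type) (A : category Ob) := BifunctorData {
  biob :> Ob -> Ob -> zmodType;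
  bimap : forall X' X Y Y', hom A X' X -> hom A Y Y' -> biob X Y -> biob X' Y'
}.

Arguments bimap {Ob A} D {X' X Y Y'} u v a : rename.

Record is_bifunctor (Ob : Type) (A : category Ob) (D : bifunctorData A) :
    Prop := {
  bimapD : forall X' X Y Y' (u : hom A X' X) (v : hom A Y Y'),
    {morph bimap D u v : a b / a + b};
  bimap_id : forall X Y (a : D X Y), bimap D (idm A X) (idm A Y) a = a;
  bimap_comp : forall X'' X' X Y Y' Y'' (u' : hom A X'' X') (u : hom A X' X)
      (v : hom A Y Y') (v' : hom A Y' Y'') (a : D X Y),
    bimap D (u \c u') (v' \c v) a = bimap D u' v' (bimap D u v a)
}.

(* [pullb u] is u^* = D(u, 1) and [pushf v] is v_* = D(1, v). *)
Definition pullb (Ob : Type) (A : category Ob) (D : bifunctorData A)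
    (X' X Y : Ob) (u : hom A X' X) (a : D X Y) : D X' Y :=
  bimap D u (idm A Y) a.

Definition pushf (Ob : Type) (A : category Ob) (D : bifunctorData A)
    (X Y Y' : Ob) (v : hom A Y Y') (a : D X Y) : D X Y' :=
  bimap D (idm A X) v a.

(* [obs e] is O(a1, a2), where [e] is the gluing condition. *)
Record ballAlgebraData (Ob : Type) := BallAlgebraData {
  bT : graded1Data Ob;
  bd : forall X Y, mor1 bT X Y -> hom bT X Y;
  bo0 : forall X Y, hom bT X Y;
  bo1 : forall X Y, mor1 bT X Y;
  bA : category Ob;
  bq : forall X Y, hom bT X Y -> hom bA X Y;
  bD : bifunctorData bA;
  obs : forall X Y (a1 a2 : mor1 bT X Y), bd a1 = bd a2 -> bD X Y
}.

Arguments bd {Ob b X Y}.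
Arguments bo0 {Ob} b X Y.
Arguments bo1 {Ob} b X Y.
Arguments bq {Ob b X Y}.
Arguments obs {Ob b X Y} [a1 a2].

(* [act a d] is a + d.  "Effective" is taken pointwise, on each (possibly empty)
   set of elements with given boundary; as the action is transitive and the
   group abelian, this is the same as effectivity on the nonempty ones. *)
Record is_ball_action (Ob : Type) (N : ballAlgebraData Ob) (X Y : Ob)
    (act : mor1 (bT N) X Y -> bD N X Y -> mor1 (bT N) X Y) : Prop := {
  act_obs : forall a d b,
    act a d = b <-> (exists e : bd b = bd a, obs e = d);
  act_bd : forall a d, bd (act a d) = bd a;
  act0 : forall a, act a 0 = a;
  actD : forall a d d', act a (d + d') = act (act a d) d';
  act_effective : forall a d, act a d = a -> d = 0;
  act_transitive : forall a b, bd a = bd b -> exists d, act a d = b;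
  obs_actl : forall a b d (e : bd (act a d) = bd b) (e' : bd a = bd b),
    obs e = obs e' + d;
  obs_actr : forall a b d (e : bd a = bd (act b d)) (e' : bd a = bd b),
    obs e = obs e' - d
}.

Record is_left_1_cubical_ball_algebra (Ob : Type) (N : ballAlgebraData Ob) :
    Prop := {
  ball_graded : is_graded1_category (bT N);
  ball_bd10 : forall X Y Z (f : mor1 (bT N) Y Z) (g : hom (bT N) X Y),
    bd (f \c10 g) = bd f \c g;
  ball_bd01 : forall X Y Z (f : hom (bT N) Y Z) (g : mor1 (bT N) X Y),
    bd (f \c01 g) = f \c bd g;
  ball_bd_zero : forall X Y, bd (bo1 N X Y) = bo0 N X Y;
  ball_o00 : forall X Y Z (g : hom (bT N) X Y), bo0 N Y Z \c g = bo0 N X Z;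
  ball_o01 : forall X Y Z (g : mor1 (bT N) X Y), bo0 N Y Z \c01 g = bo1 N X Z;
  ball_o10 : forall X Y Z (g : hom (bT N) X Y), bo1 N Y Z \c10 g = bo1 N X Z;
  ball_0o0 : forall X Y Z (f : hom (bT N) Y Z), f \c bo0 N X Y = bo0 N X Z;
  ball_1o0 : forall X Y Z (f : mor1 (bT N) Y Z), f \c10 bo0 N X Y = bo1 N X Z;
  ball_0o1 : forall X Y Z (f : hom (bT N) Y Z), f \c01 bo1 N X Y = bo1 N X Z;
  ball_q_id : forall X, bq (idm (bT N) X) = idm (bA N) X;
  ball_q_comp : forall X Y Z (g : hom (bT N) Y Z) (f : hom (bT N) X Y),
    bq (g \c f) = bq g \c bq f;
  ball_q_full : forall X Y (u : hom (bA N) X Y),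
    exists f : hom (bT N) X Y, bq f = u;
  ball_D : is_bifunctor (bD N);
  ball_D_zerol : forall X' X Y (a : bD N X Y), pullb (bq (bo0 N X' X)) a = 0;
  ball_D_zeror : forall X Y Y' (a : bD N X Y), pushf (bq (bo0 N Y Y')) a = 0;
  ball_q_zero : forall X Y (f : hom (bT N) X Y),
    bq f = bq (bo0 N X Y) <-> exists F : mor1 (bT N) X Y, bd F = f;
  ball_complement : forall X Y (a b c : mor1 (bT N) X Y)
      (eac : bd a = bd c) (eab : bd a = bd b) (ecb : bd c = bd b)
      (eba : bd b = bd a) (ebc : bd b = bd c),
    obs eac = 0 -> obs eab = obs ecb /\ obs eba = obs ebc;
  ball_double : forall X Y (a : mor1 (bT N) X Y) (e : bd a = bd a), obs e = 0;
  ball_action : forall X Y, exists act, @is_ball_action Ob N X Y act;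
  ball_natl : forall X Y Z (g : hom (bT N) Y Z) (a1 a2 : mor1 (bT N) X Y)
      (e : bd a1 = bd a2) (e' : bd (g \c01 a1) = bd (g \c01 a2)),
    obs e' = pushf (bq g) (obs e);
  ball_natr : forall X Y Z (a1 a2 : mor1 (bT N) Y Z) (f : hom (bT N) X Y)
      (e : bd a1 = bd a2) (e' : bd (a1 \c10 f) = bd (a2 \c10 f)),
    obs e' = pullb (bq f) (obs e);
  ball_trivial : forall X Y Z (f : mor1 (bT N) Y Z) (g : mor1 (bT N) X Y)
      (e : bd (bd f \c01 g) = bd (f \c10 bd g)), obs e = 0
}.

(** * Nul_1 of an abelian track category with zero maps *)

Section AutZmodule.
Variables (C : trackCategory) (abC : abelian_tracks C) (X Y : C) (f : Mor X Y).

(* [abC] is a parameter so that the zmodType instance below can use it. *)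
Definition abAut of abelian_tracks C : Type := track f f.

Local Notation Aut := (abAut abC).

HB.instance Definition _ := gen_eqMixin Aut.
HB.instance Definition _ := gen_choiceMixin Aut.

Lemma abAut_addA : associative (@gcomp (Mor X Y) f f f).
Proof. by move=> F G H; rewrite gcompA. Qed.

HB.instance Definition _ := @GRing.isZmodule.Build Aut
  (gid f) (fun F => ginv F) (fun F G => gcomp F G)
  abAut_addA (@abC X Y f) (@gcomp1t _ f f) (@gcompVt _ f f).

End AutZmodule.

Section Nul1.
Variables (C : trackCategory) (o : zeroMaps C) (abC : abelian_tracks C).

Definition nul1_mor1 (X Y : C) : Type := {f : Mor X Y & track f (o X Y)}.

Definition nul1_comp10 (X Y Z : C) (a : nul1_mor1 Y Z) (g : Mor X Y) :
    nul1_mor1 X Z :=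
  existT (fun f => track f (o X Z)) (projT1 a \m g)
    (gcast erefl (zm_mcompl o Z g) (projT2 a \h gid g)).

Definition nul1_comp01 (X Y Z : C) (g : Mor Y Z) (a : nul1_mor1 X Y) :
    nul1_mor1 X Z :=
  existT (fun f => track f (o X Z)) (g \m projT1 a)
    (gcast erefl (zm_mcompr o X g) (gid g \h projT2 a)).

Definition nul1_T : graded1Data C :=
  @Graded1Data C (C0 C) nul1_mor1 nul1_comp10 nul1_comp01.

Lemma zm_mcomplr (X' X Y Y' : C) (v : Mor Y Y') (u : Mor X' X) :
  v \m (o X Y \m u) = o X' Y'.
Proof. by rewrite zm_mcompl zm_mcompr. Qed.

(* D(u, v) sends a track o -> o to its composite with maps representing the
   homotopy classes u and v; the result does not depend on the representatives. *)
Definition nul1_D : bifunctorData (pi0 C) :=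
  @BifunctorData C (pi0 C) (fun X Y => abAut (o X Y) abC)
    (fun X' X Y Y' (u : hclass X' X) (v : hclass Y Y') (a : track (o X Y) (o X Y)) =>
      let e := zm_mcomplr (of_hclass v) (of_hclass u) in
      gcast e e (gid (of_hclass v) \h (a \h gid (of_hclass u)))).

Definition nul1_obs (X Y : C) (a1 a2 : nul1_mor1 X Y)
    (e : projT1 a1 = projT1 a2) : nul1_D X Y :=
  projT2 a1 \v ginv (gcast (esym e) erefl (projT2 a2)).

Definition Nul1 : ballAlgebraData C :=
  @BallAlgebraData C nul1_T (fun X Y (a : nul1_mor1 X Y) => projT1 a)
    (fun X Y => o X Y)
    (fun X Y => existT (fun f => track f (o X Y)) (o X Y) (gid (o X Y)))
    (pi0 C) (@to_hclass C) nul1_D nul1_obs.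

End Nul1.

(* Main.v *)
(** Everything reduces to the interchange law for the composition functor
    Mor(Y,Z) x Mor(X,Y) -> Mor(X,Z).  If H : v -> v' and K : u -> u', then
    whiskering a track a : o -> o by (v, u) or by (v', u') differs by conjugation
    with H \h (id_o \h K), which is an identity track because composing with a
    zero map trivialises tracks; so D is well defined on homotopy classes.
    Triviality expresses F \h G, for F : f -> o and G : g -> o, in two ways: as
    (F o)(f G) = f G and as (o G)(F g) = F g. *)

From mathcomp Require Import all_boot all_algebra.
From mathcomp Require Import boolp.
Require Import Defs.

Set Implicit Arguments.
Unset Strict Implicit.
Unset Printing Implicit Defensive.

Import GRing.Theory.
Local Open Scope ring_scope.

Arguments gcast : simpl never.

(** * Calculus of tracks up to transport of their endpoints *)

Section SameTrack.
Variable M : groupoid.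

Lemma same_trackP (f g f' g' : M) (F : track f g) (G : track f' g') :
  same_track F G -> exists (ef : f = f') (eg : g = g'), gcast ef eg F = G.
Proof.
(* The claim is phrased for an arbitrary total track, so rewriting by [FG] turns it into the case of
   [F] itself, where both equalities are [erefl]. *)
move=> FG; have : match total_track G with existT e H =>
    exists (ef : f = e.1) (eg : g = e.2), gcast ef eg F = H end.
  by rewrite -FG; exists erefl, erefl.
by [].
Qed.

(** Proof irrelevance makes any cast from fixed endpoints to themselves trivial. Hence identities
    can be proved up to [same_track], where casts disappear, and brought back to equality at the
    end. *)
Lemma same_track_eq (f g : M) (F G : track f g) : same_track F G -> F = G.
Proof.
case/same_trackP=> ef [eg <-].
by rewrite (Prop_irrelevance ef erefl) (Prop_irrelevance eg erefl).
Qed.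

Lemma same_gcast (f g f' g' : M) (ef : f = f') (eg : g = g') (F : track f g) :
  same_track (gcast ef eg F) F.
Proof. by case: f' / ef; case: g' / eg. Qed.

Lemma same_gid (f f' : M) : f = f' -> same_track (gid f) (gid f').
Proof. by move=> ->. Qed.

Lemma same_ginv (f g f' g' : M) (F : track f g) (F' : track f' g') :
  same_track F F' -> same_track (ginv F) (ginv F').
Proof. by case/same_trackP=> ef [eg <-]; case: f' / ef {F'}; case: g' / eg. Qed.

Lemma same_gcomp (f g h f' g' h' : M) (G : track g h) (F : track f g)
    (G' : track g' h') (F' : track f' g') :
  same_track G G' -> same_track F F' -> same_track (G \v F) (G' \v F').
Proof.
case/same_trackP=> eg [eh <-] /same_trackP[ef [eg' <-]].
rewrite (Prop_irrelevance eg' eg).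
by case: f' / ef {F'}; case: h' / eh {G'}; case: g' / eg {eg'}.
Qed.

Lemma ginv_uniq (f g : M) (F : track f g) (G : track g f) :
  G \v F = gid f -> G = ginv F.
Proof. by move=> GF; rewrite -[LHS]gcompt1 -(gcomptV F) gcompA GF gcomp1t. Qed.

Lemma ginv_gid (f : M) : ginv (gid f) = gid f.
Proof. by apply/esym/ginv_uniq; rewrite gcomp1t. Qed.

Lemma ginv_gcomp (f g h : M) (G : track g h) (F : track f g) :
  ginv (G \v F) = ginv F \v ginv G.
Proof.
apply/esym/ginv_uniq.
by rewrite -gcompA (gcompA (ginv G)) gcompVt gcomp1t gcompVt.
Qed.

End SameTrack.

(** * Interchange, whiskering and zero maps *)

Section Whiskering.
Variable C : trackCategory.

Lemma same_hcomp (X Y Z : C) (g1 g2 g1' g2' : Mor Y Z) (f1 f2 f1' f2' : Mor X Y)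
    (G : track g1 g2) (F : track f1 f2) (G' : track g1' g2')
    (F' : track f1' f2') :
  same_track G G' -> same_track F F' -> same_track (G \h F) (G' \h F').
Proof.
case/same_trackP=> e1 [e2 <-] /same_trackP[e3 [e4 <-]].
by case: g1' / e1 {G'}; case: g2' / e2; case: f1' / e3 {F'}; case: f2' / e4.
Qed.

Lemma hcomp_ginv (X Y Z : C) (g g' : Mor Y Z) (f f' : Mor X Y)
    (G : track g g') (F : track f f') : ginv G \h ginv F = ginv (G \h F).
Proof. by apply: ginv_uniq; rewrite -hcomp_gcomp !gcompVt hcomp_gid. Qed.

Lemma hcompl_gcomp (X Y Z : C) (g : Mor Y Z) (f f' f'' : Mor X Y)
    (F' : track f' f'') (F : track f f') :
  gid g \h (F' \v F) = (gid g \h F') \v (gid g \h F).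
Proof. by rewrite -hcomp_gcomp gcomp1t. Qed.

Lemma hcompr_gcomp (X Y Z : C) (f : Mor X Y) (g g' g'' : Mor Y Z)
    (G' : track g' g'') (G : track g g') :
  (G' \v G) \h gid f = (G' \h gid f) \v (G \h gid f).
Proof. by rewrite -hcomp_gcomp gcomp1t. Qed.

Lemma hcompl_ginv (X Y Z : C) (g : Mor Y Z) (f f' : Mor X Y) (F : track f f') :
  gid g \h ginv F = ginv (gid g \h F).
Proof. by rewrite -hcomp_ginv ginv_gid. Qed.

Lemma hcompr_ginv (X Y Z : C) (f : Mor X Y) (g g' : Mor Y Z) (G : track g g') :
  ginv G \h gid f = ginv (G \h gid f).
Proof. by rewrite -hcomp_ginv ginv_gid. Qed.

Lemma hcomp_lr (X Y Z : C) (g g' : Mor Y Z) (f f' : Mor X Y)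
    (G : track g g') (F : track f f') :
  G \h F = (G \h gid f') \v (gid g \h F).
Proof. by rewrite -hcomp_gcomp gcomp1t gcompt1. Qed.

Lemma hcomp_rl (X Y Z : C) (g g' : Mor Y Z) (f f' : Mor X Y)
    (G : track g g') (F : track f f') :
  G \h F = (gid g' \h F) \v (G \h gid f).
Proof. by rewrite -hcomp_gcomp gcomp1t gcompt1. Qed.

Variable o : zeroMaps C.

Lemma whisker_zero (X' X Y Y' : C) (v v' : Mor Y Y') (u u' : Mor X' X)
    (V : track v v') (U : track u u') :
  same_track (V \h (gid (o X Y) \h U)) (gid (o X' Y')).
Proof.
apply: etrans (zm_hcompr o X' V).
by apply: same_hcomp => //; apply: zm_hcompl.
Qed.

Lemma whisker_homotopic (X' X Y Y' : C) (v v' : Mor Y Y') (u u' : Mor X' X)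
    (V : track v v') (U : track u u') (a : track (o X Y) (o X Y)) :
  same_track (gid v \h (a \h gid u)) (gid v' \h (a \h gid u')).
Proof.
(* The conjugating track is compared with the identity at its target ([zl]) and at its source
   ([zr]): the naturality square [nat] is to be cancelled on both sides, and these two objects are
   only propositionally equal. *)
have zl : same_track (V \h (gid (o X Y) \h U)) (gid (v' \m (o X Y \m u'))).
  by apply: etrans (whisker_zero V U) _; apply: same_gid; rewrite zm_mcomplr.
have zr : same_track (V \h (gid (o X Y) \h U)) (gid (v \m (o X Y \m u))).
  by apply: etrans (whisker_zero V U) _; apply: same_gid; rewrite zm_mcomplr.
have nat : (V \h (gid (o X Y) \h U)) \v (gid v \h (a \h gid u)) =
    (gid v' \h (a \h gid u')) \v (V \h (gid (o X Y) \h U)).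
  by rewrite -!hcomp_gcomp !gcomp1t !gcompt1.
have zV : same_track (gid (v' \m (o X Y \m u'))) (gid (v \m (o X Y \m u))).
  by apply: same_gid; rewrite !zm_mcomplr.
rewrite -[gid v \h _]gcomp1t -[gid v' \h _]gcompt1.
apply: etrans (same_gcomp (esym zr) erefl) _; rewrite nat.
exact: same_gcomp erefl zl.
Qed.

End Whiskering.

(** * The graded category and the bifunctor *)

Section Nul1Algebra.
Variables (C : trackCategory) (o : zeroMaps C) (abC : abelian_tracks C).

Lemma nul1_mor1_eq (X Y : C) (a b : nul1_mor1 o X Y) :
  same_track (projT2 a) (projT2 b) -> a = b.
Proof.
case: a b => [f F] [g G] /= /same_trackP[efg [e <-]].
by case: g / efg {G}; rewrite (Prop_irrelevance e erefl).
Qed.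

(** Injectivity of the dependent pair in its second component comes from proof irrelevance, through
    total tracks. *)
Lemma nul1_mor1_inj (X Y : C) (f : Mor X Y) (F G : track f (o X Y)) :
  existT (fun g => track g (o X Y)) f F = existT _ f G -> F = G.
Proof.
move=> FG; apply: same_track_eq.
exact (congr1 (fun a : nul1_mor1 o X Y => total_track (projT2 a)) FG).
Qed.

(** [nul1_D] whiskers by chosen representatives; these are joined by tracks to [u] and [v], so
    homotopy invariance of whiskering allows any representatives. *)
Lemma same_bimap (X' X Y Y' : C) (u : Mor X' X) (v : Mor Y Y')
    (a : nul1_D o abC X Y) :
  same_track (bimap (nul1_D o abC) (to_hclass u : hom (pi0 C) X' X)
                (to_hclass v : hom (pi0 C) Y Y') a)
    (gid v \h ((a : track (o X Y) (o X Y)) \h gid u)).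
Proof.
have [U] := to_hclass_of u; have [V] := to_hclass_of v.
exact: etrans (same_gcast _ _ _) (whisker_homotopic V U a).
Qed.

Lemma same_pullb (X' X Y : C) (u : Mor X' X) (a : nul1_D o abC X Y) :
  same_track (pullb (D := nul1_D o abC) (to_hclass u : hom (pi0 C) X' X) a)
    ((a : track (o X Y) (o X Y)) \h gid u).
Proof. exact: etrans (same_bimap u (mid Y) a) (hcomp1t _). Qed.

Lemma same_pushf (X Y Y' : C) (v : Mor Y Y') (a : nul1_D o abC X Y) :
  same_track (pushf (D := nul1_D o abC) (to_hclass v : hom (pi0 C) Y Y') a)
    (gid v \h (a : track (o X Y) (o X Y))).
Proof.
apply: etrans (same_bimap (mid X) v a) _.
by apply: same_hcomp => //; apply: hcompt1.
Qed.

Lemma nul1_graded : is_graded1_category (nul1_T o).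
Proof.
split=> [X Y Z W f g h|X Y Z W f g h|X Y Z W f g h|X Y f|X Y f];
  apply: nul1_mor1_eq => /=; apply: etrans (same_gcast _ _ _) _.
- apply/esym; apply: etrans (same_gcast _ _ _) _.
  apply: etrans (same_hcomp (same_gcast _ _ _) erefl) _.
  by rewrite -hcomp_gid; apply/esym/hcompA.
- apply: etrans (same_hcomp erefl (same_gcast _ _ _)) _.
  apply/esym; apply: etrans (same_gcast _ _ _) _.
  apply: etrans (same_hcomp (same_gcast _ _ _) erefl) _.
  exact/esym/hcompA.
- apply: etrans (same_hcomp erefl (same_gcast _ _ _)) _.
  apply/esym; apply: etrans (same_gcast _ _ _) _.
  by rewrite -hcomp_gid; apply/esym/hcompA.
- exact: hcomp1t.
- exact: hcompt1.
Qed.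

Lemma nul1_bifunctor : is_bifunctor (nul1_D o abC).
Proof.
split=> [X' X Y Y' u v a b|X Y a|X'' X' X Y Y' Y'' u' u v v' a].
- apply: same_track_eq; apply: etrans (same_gcast _ _ _) _.
  (* Addition in D is vertical composition, so additivity is functoriality of whiskering. *)
  rewrite (hcompr_gcomp _ (a : track _ _) b) hcompl_gcomp.
  by apply/esym/same_gcomp; apply: same_gcast.
- apply: same_track_eq; apply: etrans (same_bimap (mid X) (mid Y) a) _.
  by apply: etrans (hcomp1t _) _; apply: hcompt1.
(* Once every class is written with a representative, composites of classes are represented by
   composites of maps, and only reassociation is left. *)
- rewrite -(of_hclassK u) -(of_hclassK u') -(of_hclassK v) -(of_hclassK v') /=.
  rewrite !hclass_compE; apply: same_track_eq.
  apply: etrans (same_bimap _ _ _) _.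
  apply/esym; apply: etrans (same_bimap _ _ _) _.
  apply: etrans (same_hcomp erefl (same_hcomp (same_bimap _ _ _) erefl)) _.
  rewrite -!hcomp_gid; apply/esym.
  apply: etrans (esym (hcompA _ _ _)) _; apply: same_hcomp => //.
  apply: etrans (hcompA _ _ _) _; apply: etrans (hcompA _ _ _) _.
  apply: same_hcomp => //; exact/esym/hcompA.
Qed.

(** * The obstruction and the action *)

Lemma same_obs (X Y : C) (a b : nul1_mor1 o X Y) (e : projT1 a = projT1 b)
    (f g : Mor X Y) (F G : track f g) :
  same_track (projT2 a) F -> same_track (projT2 b) G ->
  same_track (nul1_obs abC e : track _ _) (F \v ginv G).
Proof.
move=> aF bG; apply: same_gcomp aF (same_ginv _).
exact: etrans (same_gcast _ _ _) bG.
Qed.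

Lemma obs_existT (X Y : C) (f : Mor X Y) (F G : track f (o X Y)) (e : f = f) :
  @nul1_obs C o abC X Y (existT _ f F) (existT _ f G) e = F \v ginv G.
Proof. exact/same_track_eq/same_obs. Qed.

(** This is the only possible choice: F'F^{-1} = d forces F' = dF. *)
Definition nul1_act (X Y : C) (a : nul1_mor1 o X Y) (d : nul1_D o abC X Y) :
    nul1_mor1 o X Y :=
  existT (fun f => track f (o X Y)) (projT1 a)
    ((d : track (o X Y) (o X Y)) \v projT2 a).

Lemma nul1_action (X Y : C) : @is_ball_action C (Nul1 o abC) X Y (@nul1_act X Y).
Proof.
have actE (f : Mor X Y) (F : track f (o X Y)) (d : nul1_D o abC X Y) :
  nul1_act (existT _ f F) d = existT _ f ((d : track _ _) \v F) by [].
split=> /=.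
- move=> [f F] d b; rewrite actE; split=> [<-|[]].
    by exists erefl; rewrite obs_existT -gcompA gcomptV gcompt1.
  case: b => g G /= e; case: f / e F => F; rewrite obs_existT => <-.
  by rewrite -gcompA gcompVt gcompt1.
- by [].
- by move=> [f F]; rewrite actE [_ \v _]gcomp1t.
(* Composing on the left gives a left action; commutativity of the automorphism group makes it a
   right one. *)
- by move=> [f F] d d'; rewrite !actE gcompA addrC.
- move=> [f F] d; rewrite actE => /nul1_mor1_inj dF.
  by rewrite -[LHS]gcompt1 -(gcomptV F) gcompA [_ \v F]dF gcomptV.
- move=> [f F] [g G] /= e; case: g / e G => G.
  by exists (G \v ginv F); rewrite actE -gcompA gcompVt gcompt1.
(* dFG^{-1} has d on the left, so commutativity is used again; below, F(dG)^{-1} = FG^{-1}d^{-1}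
   already has the right order. *)
- move=> [f F] [g G] d /= e e'; case: g / e' e G => e G.
  by rewrite [LHS]obs_existT obs_existT /= -gcompA addrC.
- move=> [f F] [g G] d /= e e'; case: g / e' e G => e G.
  by rewrite [LHS]obs_existT obs_existT /= ginv_gcomp gcompA.
Qed.

(** Cancelling G in FG^{-1} = id gives F = G, which reduces the complement rule to a
    substitution. *)
Lemma nul1_obs0_eq (X Y : C) (a c : nul1_mor1 o X Y)
    (eac : projT1 a = projT1 c) :
  nul1_obs abC eac = 0 -> a = c.
Proof.
case: a c eac => [f F] [g G] /= e; case: g / e G => G; rewrite obs_existT => FG.
congr existT.
by rewrite -[F]gcompt1 -(gcompVt G) gcompA [_ \v ginv G]FG gcomp1t.
Qed.

End Nul1Algebra.

(** * Verification of the axioms *)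

Theorem proposition12p2 (C : trackCategory) (o : zeroMaps C)
    (abC : abelian_tracks C) :
  is_left_1_cubical_ball_algebra (Nul1 o abC).
Proof.
have zero_gid (X Y : C) (f : Mor X Y) (F : track f (o X Y)) :
    same_track F (gid (o X Y)) ->
    existT (fun g => track g (o X Y)) f F = bo1 (Nul1 o abC) X Y.
  by move=> F0; apply: nul1_mor1_eq.
split=> /=.
- exact: nul1_graded.
- by [].
- by [].
- by [].
- exact: zm_mcompl.
- move=> X Y Z g; apply: zero_gid; apply: etrans (same_gcast _ _ _) _.
  exact: zm_hcompl.
- move=> X Y Z g; apply: zero_gid; apply: etrans (same_gcast _ _ _) _.
  exact: zm_hcompl.
- exact: zm_mcompr.
- move=> X Y Z g; apply: zero_gid; apply: etrans (same_gcast _ _ _) _.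
  exact: zm_hcompr.
- move=> X Y Z g; apply: zero_gid; apply: etrans (same_gcast _ _ _) _.
  exact: zm_hcompr.
- by [].
- by move=> X Y Z g f; rewrite hclass_compE.
- by move=> X Y u; exists (of_hclass u); apply: of_hclassK.
- exact: nul1_bifunctor.
- move=> X' X Y a; apply: same_track_eq; apply: etrans (same_pullb _ _) _.
  exact: zm_hcompr.
- move=> X Y Y' a; apply: same_track_eq; apply: etrans (same_pushf _ _) _.
  exact: zm_hcompl.
(* A track from f to the zero map is the same thing as a morphism of dimension 1 with boundary f. *)
- move=> X Y f; split=> [/to_hclassP[F]|[[g G] /= <-]].
    by exists (existT _ f F).
  by apply/to_hclassP.
- move=> X Y a b c eac eab ecb eba ebc /nul1_obs0_eq ac.
  rewrite -{}ac in eac ecb ebc *.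
  by rewrite (Prop_irrelevance ecb eab) (Prop_irrelevance ebc eba).
- by move=> X Y [f F] e; rewrite obs_existT gcomptV.
- by move=> X Y; exists (@nul1_act C o abC X Y); apply: nul1_action.
(* Naturality on either side: whiskering preserves vertical composites and inverses, hence
   FG^{-1}. *)
- move=> X Y Z g [f F] [f' G] /= e e'; case: f' / e e' G => e' G.
  apply: same_track_eq; apply/esym; apply: etrans (same_pushf _ _) _.
  rewrite obs_existT hcompl_gcomp hcompl_ginv; apply/esym.
  by apply: same_obs; apply: same_gcast.
- move=> X Y Z [f F] [f' G] g /= e e'; case: f' / e e' G => e' G.
  apply: same_track_eq; apply/esym; apply: etrans (same_pullb _ _) _.
  rewrite obs_existT hcompr_gcomp hcompr_ginv; apply/esym.
  by apply: same_obs; apply: same_gcast.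
- move=> X Y Z [f F] [g G] /= e; apply: same_track_eq.
  (* In each factorization of F \h G, the factor left over whiskers a track by a zero map and is
     therefore an identity. *)
  have fG : same_track (gid f \h G) (F \h G).
    apply/esym; rewrite hcomp_lr -[RHS]/(total_track _).
    rewrite -[gid f \h G in RHS]gcomp1t; apply: same_gcomp => //.
    by apply: etrans (zm_hcompr o X F) _; apply: same_gid; rewrite zm_mcompr.
  have Fg : same_track (F \h gid g) (F \h G).
    apply/esym; rewrite hcomp_rl -[RHS]/(total_track _).
    rewrite -[F \h gid g in RHS]gcomp1t; apply: same_gcomp => //.
    by apply: etrans (zm_hcompl o Z G) _; apply: same_gid; rewrite zm_mcompl.
  (* Both elements carry the track F \h G, so their obstruction is F \h G followed by cancellation
     with its own inverse. *)
  apply: etrans (same_obs (F := F \h G) (G := F \h G) abC _ _ _) _.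
  + exact: etrans (same_gcast _ _ _) fG.
  + exact: etrans (same_gcast _ _ _) Fg.
  + by rewrite gcomptV; apply: same_gid; rewrite zm_mcompl.
Qed.
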